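(* Let $w:\mathbb{Z}^+\to\mathbb{R}$ be a non-negative increasing function, and let $u:\mathbb{Z}^+\to\mathbb{C}$ be a function vanishing at infinity, with decreasing rearrangement $\widetilde u$. Then for all $p\ge 1$, $$\sum_{n\in\mathbb{Z}^+}|u(n)-u(n+1)|^p\,w(n)\ \ge\ \sum_{n\in\mathbb{Z}^+}|\widetilde u(n)-\widetilde u(n+1)|^p\,w(n).$$ Moreover, if $w(n)>0$ for all $n\in\mathbb{Z}^+$ and $u$ produces equality in this inequality, then $|u|=\widetilde u$. In particular, $|u|$ is a decreasing function.
   Context: $\mathbb{Z}^+=\{0,1,2,\dots\}$ is the set of non-negative integers. ''Increasing'' and ''decreasing'' are meant in the weak sense ($w(n)\le w(n+1)$, respectively $|u(n)|\ge |u(n+1)|$, for all $n$). A function $u:\mathbb{Z}^+\to\mathbb{C}$ vanishes at infinity if $\{n\in\mathbb{Z}^+:|u(n)|>t\}$ is finite for every $t>0$. For a finite set $A\subset\mathbb{Z}^+$ with $|A|=k$, its symmetric rearrangement $A^*$ is the set of all non-negative integers less than or equal to $k-1$ (empty if $k=0$). For $u$ vanishing at infinity, its decreasing rearrangement $\widetilde u:\mathbb{Z}^+\to[0,\infty)$ is $$\widetilde u(n):=\int_0^\infty \chi_{\{|u|>t\}^*}(n)\,dt,$$ where $\chi_S$ is the characteristic function of $S$. (Thus $\widetilde u(0)$ is the largest value of $|u|$, $\widetilde u(1)$ the second largest, and so on, with multiplicity.)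
   Formalization: In the equality case the common value of the two sums is assumed finite; otherwise the claim fails, e.g. u(0)=1/2, u(1)=1, u(n)=1/(n+1) for n≥2, w(n)=(n+1)^{2p}, where both sums are infinite but |u| is not decreasing. *)

(* Defs.v *)
From HB Require Import structures.
From mathcomp Require Import all_boot all_order all_algebra finmap.
From mathcomp Require Import all_classical all_reals all_analysis.
From mathcomp Require Import complex.
Import Order.TTheory GRing.Theory Num.Theory.
Import numFieldNormedType.Exports.
Set Implicit Arguments.
Unset Strict Implicit.
Unset Printing Implicit Defensive.
Local Open Scope classical_set_scope.
Local Open Scope ring_scope.

(* [`|z|] has values in [R[i]]; the real-valued modulus is [normc]. *)
Notation cmod := ComplexField.Normc.normc.

Definition vanishes_at_infinity (R : realType) (u : nat -> R[i]) : Prop :=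
  forall t : R, 0 < t -> finite_set [set n | t < cmod (u n)].

(* [n < k] rather than [n <= k.-1], so that the result is empty when [k = 0].
   If A is infinite, [fset_set A] is empty, hence so is the result. *)
Definition symm_rearr (A : set nat) : set nat :=
  [set n | (n < #|` fset_set A|)%N].

(* The domain excludes [t = 0], where the level set may be infinite. *)
Definition decr_rearr (R : realType) (u : nat -> R[i]) (n : nat) : R :=
  \int[lebesgue_measure]_(t in `]0, +oo[)
    \1_(symm_rearr [set m | t < cmod (u m)]) n.

(* Main.v *)
Require Import Defs.
From HB Require Import structures.
From mathcomp Require Import all_boot all_order all_algebra finmap.
From mathcomp Require Import all_classical all_reals all_analysis.
From mathcomp Require Import complex.
Import Order.TTheory GRing.Theory Num.Theory.
Import numFieldNormedType.Exports.
Local Open Scope classical_set_scope.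
Local Open Scope ring_scope.

(** Write [a n] for the modulus of [u n] and [b] for the decreasing
    rearrangement. The layer-cake integral defining [b] is used only through one
    property: for [t > 0], [t < b n] if and only if more than [n] values of [a]
    exceed [t] ([decr_rearr_gt]).

    Suppose [b n.+1 < b n]. No value of [a] lies strictly between these two
    numbers, and the set of indices where [a] is above the gap has [n.+1]
    elements. Let [m] be its last element. Then [n <= m], and from [m] to [m.+1]
    the sequence [a] jumps down across the whole gap: [b n <= a m] and
    [a m.+1 <= b n.+1] ([rearranges_descent]). So every descent of [b] is
    matched with a descent of [a] that contains it and carries a weight at least
    as large, [w] being nondecreasing. The descents of [b] matched with the same
    [m] are disjoint, so their lengths add up to at most [a m - a m.+1]
    ([sum_matched_descents]), and since [x `^ p] is superadditive for [p >= 1]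
    ([powR_sum_le]) the same holds for their [p]-th powers. Summing over [m]
    bounds the energy of [b] by the energy that [a] spends on its descents
    ([rearranges_energy_le]), which is at most the energy of [u] by the reverse
    triangle inequality.

    In the case of equality, the energy of [u] being finite, this last
    comparison is an equality term by term. If [w] is positive, [a] then has no
    ascent, since an ascent contributes to the energy of [u] but not to that of
    the descents of [a]. A nonincreasing nonnegative sequence vanishing at
    infinity is its own decreasing rearrangement ([rearranges_id]). *)

(** * Counting finite sets of integers *)

Lemma fset_card_subset (A B : set nat) : finite_set A -> finite_set B ->
  A `<=` B -> (#|` fset_set A| <= #|` fset_set B|)%N.
Proof.
by move=> fA fB AB; apply: fsubset_leq_card; rewrite -fset_set_sub.
Qed.

Lemma fset_card_subset_eq (A B : set nat) : finite_set A -> finite_set B ->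
  A `<=` B -> #|` fset_set A| = #|` fset_set B| -> A = B.
Proof.
move=> fA fB AB cAB; suff E : fset_set A = fset_set B.
  by rewrite -(fset_setK fA) E fset_setK.
by apply/fsetP/(fsubset_cardP cAB); rewrite -fset_set_sub.
Qed.

Lemma fset_card_gt_sup (A : set nat) (n : nat) : finite_set A ->
  (n < #|` fset_set A|)%N ->
  exists m, [/\ (n <= m)%N, A m & ~ A m.+1].
Proof.
move=> fA ltn.
have exA : exists k, `[< A k >].
  apply/not_existsP => A0; move: ltn; rewrite (_ : A = set0) ?fset_set0//.
  by apply/seteqP; split=> // k Ak; case: (A0 k); exact/asboolP.
have ubA k : `[< A k >] -> (k <= \max_(i <- fset_set A) i)%N.
  move=> /asboolP Ak; apply: (leq_bigmax_seq (F := id)) => //.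
  by rewrite in_fset_set// inE.
case: (ex_maxnP exA ubA) => m /asboolP Am maxm.
exists m; split=> //; last by move/asboolP/maxm; rewrite ltnn.
rewrite -ltnS (leq_trans ltn)//; apply: geq_card_fset_set.
by apply: subset_card_le => k /asboolP /maxm; rewrite /= ltnS.
Qed.

(** * Level sets and the layer-cake formula *)

Definition level {R : realType} (a : nat -> R) (t : R) : set nat :=
  [set n | t < a n].

Lemma level_subset {R : realType} (a : nat -> R) (s t : R) :
  s <= t -> level a t `<=` level a s.
Proof. by move=> st n; exact: le_lt_trans. Qed.

(** The finitely many values above [t] stay away from [t]. *)
Lemma level_right_stable {R : realType} (a : nat -> R) (t : R) :
  finite_set (level a t) -> exists2 s, t < s & level a t `<=` level a s.
Proof.
move=> fin; have sub n : n \in (fset_set (level a t) : seq nat) -> t < a n.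
  by rewrite in_fset_set// inE.
suff [s ts sa] : exists2 s, t < s &
    forall n, n \in (fset_set (level a t) : seq nat) -> s < a n.
  by exists s => // n tn; apply: sa; rewrite in_fset_set// inE.
elim: (fset_set _ : seq nat) sub => [_|k X IH sub].
  by exists (t + 1); rewrite ?ltrDl.
case: IH => [n nX|s ts sX]; first by apply: sub; rewrite inE nX orbT.
have tk : t < a k by apply: sub; rewrite inE eqxx.
exists (Num.min s ((t + a k) / 2)).
  by rewrite lt_min ts midf_lt.
move=> n; rewrite inE => /predU1P[->|/sX]; rewrite gt_min.
  by rewrite (midf_lt tk) orbT.
by move=> ->.
Qed.

Lemma initial_interval_sup {R : realType} (S : set R) :
  S `<=` [set t | 0 < t] -> has_ubound S ->
  (forall s t, 0 < s -> s <= t -> S t -> S s) ->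
  (forall t, S t -> exists2 s, t < s & S s) -> S = `]0, sup S[%classic.
Proof.
move=> Spos Sub Sdown Sopen; apply/seteqP; split=> t /=; rewrite in_itv/=.
  move=> St; rewrite (Spos _ St)/=; have [s ts Ss] := Sopen _ St.
  exact: lt_le_trans ts (ub_le_sup Sub Ss).
case/andP=> t0 tS; have [S0|/set0P S0] := eqVneq S set0.
  by move: tS; rewrite S0 sup0 ltNge ltW.
by have [s Ss ts] := sup_gt S0 tS; exact: (Sdown _ _ t0 (ltW ts)).
Qed.

Lemma Rintegral_indic_initial {R : realType} (x : R) : 0 <= x ->
  \int[lebesgue_measure]_(t in `]0, +oo[) (\1_(`]0, x[%classic : set R) t : R)
  = x.
Proof.
move=> x0; rewrite /Rintegral.
rewrite integral_indic//=.
rewrite (_ : _ `&` _ = `]0, x[%classic); last first.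
  apply/seteqP; split=> t /=; rewrite !in_itv/= ?andbT; first by case.
  by case/andP=> -> ->.
rewrite lebesgue_measure_itv/= lte_fin.
by case: ltP => [_|xl]/=; [rewrite subr0|apply/eqP; rewrite eq_le x0 xl].
Qed.

Lemma cmod_ge0 {R : realType} (z : R[i]) : 0 <= cmod z.
Proof. by case: z => x y; exact: sqrtr_ge0. Qed.

(** The numbers [t > 0] exceeded by more than [n] values of the modulus of [u]
    form an initial interval of the half-line, open at its right end because the
    level sets are finite. The integral defining [decr_rearr u n] is the length
    of this interval. *)
Lemma decr_rearr_gt {R : realType} (u : nat -> R[i]) :
  vanishes_at_infinity u -> forall n,
  0 <= decr_rearr u n /\ forall t, 0 < t ->
  (t < decr_rearr u n) = (n < #|` fset_set (level (fun m => cmod (u m)) t)|)%N.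
Proof.
move=> uv n.
set D := fun t : R => #|` fset_set (level (fun m => cmod (u m)) t)|.
pose S := [set t : R | 0 < t /\ (n < D t)%N].
have Sub : has_ubound S.
  pose X := fset_set (level (fun m => cmod (u m)) 1).
  (* A value above 1 is one of finitely many, so their sum is a bound. *)
  exists (\sum_(k <- X) cmod (u k) + 1) => t [t0 /fset_card_gt_sup].
  case=> [|m [_ /= tm _]]; first exact: uv.
  have [m1|m1] := leP (cmod (u m)) 1.
    rewrite (le_trans (ltW tm))// (le_trans m1)// lerDr sumr_ge0// => k _.
    exact: cmod_ge0.
  apply: le_trans (ltW tm) _; apply: ler_wpDr => //.
  rewrite (big_fsetD1 m)/=.
    by rewrite lerDl sumr_ge0// => k _; exact: cmod_ge0.
  by rewrite in_fset_set ?inE//; exact: uv.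
have SE : S = `]0, sup S[%classic.
  apply: initial_interval_sup Sub _ _ => [t []//|s t s0 st [t0 Dt]|t [t0 Dt]].
    split=> //; apply: leq_trans Dt _.
    by apply: fset_card_subset; [apply: uv..|exact: level_subset].
  have [s ts sub] := level_right_stable _ _ (uv _ t0).
  have s0 := lt_trans t0 ts.
  exists s => //; split=> //; apply: leq_trans Dt _.
  by apply: fset_card_subset => //; exact: uv.
have supS0 : 0 <= sup S.
  have [S0|/set0P[t St]] := eqVneq S set0; first by rewrite S0 sup0.
  by apply: le_trans (ub_le_sup Sub St); case: St => /ltW.
have -> : decr_rearr u n = sup S.
  rewrite -[RHS](Rintegral_indic_initial _ supS0) -SE /decr_rearr.
  apply: eq_Rintegral => t; rewrite inE/= in_itv/= andbT => t0.
  rewrite !indicE; congr (_%:R); congr (nat_of_bool _).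
  by apply/idP/idP; rewrite !inE /S /symm_rearr /=; [split|case].
split=> // t t0; apply/idP/idP => [tS|Dt].
  by have [] : S t by rewrite SE /= in_itv/= t0 tS.
have : S t by [].
by rewrite {1}SE /= in_itv/= => /andP[].
Qed.

(** * Decreasing rearrangements of real sequences *)

(** [b] is nonnegative and is the generalized inverse of the distribution
    function of [a]; for [a] nonnegative and vanishing at infinity this
    characterizes its decreasing rearrangement. *)
Definition rearranges {R : realType} (b a : nat -> R) : Prop :=
  (forall n, 0 <= b n) /\
  (forall n t, 0 < t -> (t < b n) = (n < #|` fset_set (level a t)|)%N).

Lemma rearranges_nonincreasing {R : realType} (b a : nat -> R) :
  rearranges b a -> forall n, b n.+1 <= b n.
Proof.
case=> b0 ba n; rewrite leNgt; apply/negP => lt_b.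
have t0 : 0 < (b n + b n.+1) / 2.
  by apply: le_lt_trans (b0 n) _; exact: (midf_lt lt_b).1.
have : (b n + b n.+1) / 2 < b n.+1 by exact: (midf_lt lt_b).2.
rewrite ba// => /ltnW; rewrite -ba// ltNge.
by rewrite (ltW (midf_lt lt_b).1).
Qed.

Lemma eq_from_gt_pos {R : realType} (x y : R) : 0 <= x -> 0 <= y ->
  (forall t, 0 < t -> (t < x) = (t < y)) -> x = y.
Proof.
wlog lt_xy : x y / x < y => [wlg x0 y0 xy|x0 _ xy].
  have [lt_xy|lt_yx|//] := ltgtP x y; first exact: wlg.
  by apply/esym/wlg => // t t0; rewrite xy.
have [xt ty] := midf_lt lt_xy.
by move: ty; rewrite -xy ?(le_lt_trans x0)// ltNge ltW.
Qed.

Lemma rearranges_id {R : realType} (b a : nat -> R) :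
  (forall n, 0 <= a n) -> (forall t, 0 < t -> finite_set (level a t)) ->
  nonincreasing_seq a -> rearranges b a -> a = b.
Proof.
move=> a0 afin a_dec [b0 ba].
have gt_ab n t : 0 < t -> (t < b n) = (t < a n).
  move=> t0; rewrite ba//; apply/idP/idP => [|ta].
    apply: contraTT; rewrite -leNgt -leqNgt => at_; apply: geq_card_fset_set.
    apply: subset_card_le => k; rewrite /level /= => tk.
    rewrite ltnNge; apply/negP => nk.
    by move: (lt_le_trans tk (le_trans (a_dec _ _ nk) at_)); rewrite ltxx.
  apply: leq_card_fset_set; first exact: afin.
  apply: subset_card_le => k /=; rewrite ltnS => kn.
  exact: lt_le_trans ta (a_dec _ _ kn).
by apply/funext => n; apply: eq_from_gt_pos => // t t0; rewrite gt_ab.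
Qed.

(** At all levels strictly between [b n.+1] and [b n], the level set of [a] is
    the same set of [n.+1] integers. Its maximum is the [m] sought; a set of
    [n.+1] integers has a maximum at least [n]. *)
Lemma rearranges_descent {R : realType} (b a : nat -> R) (n : nat) :
  (forall t, 0 < t -> finite_set (level a t)) -> rearranges b a ->
  b n.+1 < b n -> exists m, [/\ (n <= m)%N, b n <= a m & a m.+1 <= b n.+1].
Proof.
move=> afin [b0 ba] lt_b.
have card_level t : b n.+1 < t -> t < b n -> #|` fset_set (level a t)| = n.+1.
  move=> bt tb; have t0 := le_lt_trans (b0 _) bt.
  apply/eqP; rewrite eqn_leq; apply/andP; split; last by rewrite -ba.
  by rewrite leqNgt -ba// -leNgt ltW.
have level_eq s t : b n.+1 < s -> s <= t -> t < b n -> level a s = level a t.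
  move=> bs st tb; have s0 := le_lt_trans (b0 _) bs.
  apply/esym/fset_card_subset_eq; [apply: afin; exact: lt_le_trans st
    |exact: afin|exact: level_subset|].
  by rewrite !card_level// ?(lt_le_trans bs)// (le_lt_trans st).
set t := (b n.+1 + b n) / 2; have [bt tb] : b n.+1 < t /\ t < b n.
  by rewrite !(midf_lt lt_b).
have t0 := le_lt_trans (b0 _) bt.
have ltn : (n < #|` fset_set (level a t)|)%N by rewrite card_level.
have [m [nm tm /negP]] := fset_card_gt_sup _ _ (afin _ t0) ltn.
rewrite -leNgt => mt.
exists m; split=> //.
- rewrite leNgt; apply/negP => ab.
  have : level a (a m) m by rewrite -(level_eq t) ?(ltW tm).
  by rewrite /level /= ltxx.
- rewrite leNgt; apply/negP => ba1.
  have [bs sa] := midf_lt ba1; set s := _ / 2 in bs sa.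
  have : level a s m.+1 by [].
  rewrite (level_eq s t) ?(le_trans (ltW sa))//.
  by rewrite /level /= ltNge mt.
Qed.

(** * Superadditivity of powers and telescoping of descents *)

Lemma powR_sum_le {R : realType} (p : R) (I : Type) (s : seq I) (P : pred I)
    (x : I -> R) : 1 <= p -> (forall i, P i -> 0 <= x i) ->
  \sum_(i <- s | P i) x i `^ p <= (\sum_(i <- s | P i) x i) `^ p.
Proof.
move=> p1 x0; have p0 : 0 < p by exact: lt_le_trans p1.
elim: s => [|i s IH]; first by rewrite !big_nil powR_ge0.
rewrite !big_cons; case: ifPn => // Pi.
set S := \sum_(j <- s | P j) x j in IH *.
have S0 : 0 <= S by apply: sumr_ge0.
have xi0 := x0 _ Pi.
apply: (@le_trans _ _ (x i `^ p + S `^ p)); first by rewrite lerD2l IH.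
(* Split [z `^ p] as [z * z `^ (p - 1)]; the second factor is monotone. *)
rewrite -(mulr_powRB1 xi0 p0) -(mulr_powRB1 S0 p0).
rewrite -(mulr_powRB1 (addr_ge0 xi0 S0) p0) mulrDl.
by apply: lerD; apply: ler_wpM2l => //; apply: ge0_ler_powR;
  rewrite ?subr_ge0 ?nnegrE ?addr_ge0// ?lerDl ?lerDr.
Qed.

(** Clamping [b] to the interval from [lo] to [hi] leaves the descents selected
    by [P] unchanged and makes no other descent negative, so the full sum of the
    clamped differences is an upper bound, and it telescopes. When [hi < lo] the
    clamp is constant, hence the [0] in the bound. *)
Lemma sum_matched_descents {R : realType} (b : nat -> R) (lo hi : R) (N : nat)
    (P : pred nat) : (forall n, b n.+1 <= b n) ->
  (forall n, P n -> lo <= b n.+1 /\ b n <= hi) ->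
  \sum_(0 <= n < N | P n) (b n - b n.+1) <= Num.max 0 (hi - lo).
Proof.
move=> b_dec Plh; pose c x : R := Num.max lo (Num.min x hi).
have c_mono x y : x <= y -> c x <= c y.
  move=> xy; rewrite /c ge_max !le_max lexx/=; apply/orP; right.
  by rewrite le_min !ge_min xy lexx orbT.
have step n : (if P n then b n - b n.+1 else 0) <= - (c (b n.+1) - c (b n)).
  rewrite opprB; case: ifPn => [/Plh[lo_b b_hi]|_]; last first.
    by rewrite subr_ge0 c_mono.
  have bb := b_dec n.
  by rewrite /c !min_l ?max_r// ?(le_trans bb)// (le_trans lo_b).
rewrite big_mkcond; apply: le_trans (ler_sum_nat (fun n _ => step n)) _.
rewrite sumrN telescope_sumr// opprB.
have : lo <= c (b N) by rewrite le_max lexx.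
have : c (b 0%N) <= Num.max lo hi.
  by rewrite /c ge_max !le_max lexx/= [_ <= hi]ge_min lexx !orbT.
by rewrite -(subrr lo) -addr_maxl => h1 h2; apply: lerB.
Qed.

(** * Comparing series through a map of the indices *)

(** A finite partial sum of [f] meets finitely many fibres of [phi]; grouping it
    by fibres bounds it by a partial sum of [g]. *)
Lemma nneseries_le_fibres {R : realType} (f g : nat -> R) (phi : nat -> nat) :
  (forall n, 0 <= f n) -> (forall n, 0 <= g n) ->
  (forall m N, \sum_(0 <= n < N | phi n == m) f n <= g m) ->
  (\sum_(0 <= n <oo) (f n)%:E <= \sum_(0 <= n <oo) (g n)%:E)%E.
Proof.
move=> f0 g0 fib; apply: lime_le.
  by apply: is_cvg_nneseries => n _ _; rewrite lee_fin.
apply: nearW => N.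
pose M := (\max_(n < N) phi n).+1.
apply: le_trans (@nneseries_lim_ge _ _ xpredT 0%N M _); last first.
  by move=> n _ _; rewrite lee_fin.
rewrite !sumEFin lee_fin (big_mkord _ g) big_mkord.
have phiM (n : 'I_N) : (phi n < M)%N by rewrite ltnS (leq_bigmax n).
rewrite (partition_big (fun n => Ordinal (phiM n)) xpredT)//=.
by apply: ler_sum => m _; have := fib m N; rewrite big_mkord.
Qed.

(** Both series are split at one index; the remainders are finite, so they can
    be compared and cancelled. *)
Lemma nneseries_eq_termwise {R : realType} (f g : nat -> R) :
  (forall n, 0 <= f n) -> (forall n, f n <= g n) ->
  (\sum_(0 <= n <oo) (g n)%:E < +oo)%E ->
  (\sum_(0 <= n <oo) (g n)%:E <= \sum_(0 <= n <oo) (f n)%:E)%E ->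
  forall n, f n = g n.
Proof.
move=> f0 fg g_fin gf k; apply/eqP; rewrite eq_le fg/=.
have g0 n : 0 <= g n by exact: le_trans (fg n).
have f0' n : xpredT n -> (0 <= (f n)%:E)%E by rewrite lee_fin.
have g0' n : xpredT n -> (0 <= (g n)%:E)%E by rewrite lee_fin.
move: g_fin gf.
rewrite (nneseriesD1 (n := k) f0')// (nneseriesD1 (n := k) g0')//=.
set F := \big[_/_]_(0 <= i <oo | _) (f i)%:E.
set G := \big[_/_]_(0 <= i <oo | _) (g i)%:E => Gfin.
have FG : (F <= G)%E by apply: lee_nneseries => [n _ _|n _]; rewrite lee_fin.
move=> gf; have G0 : (0 <= G)%E.
  by apply: nneseries_ge0 => n _ _; rewrite lee_fin.
have GE : G \is a fin_num.
  by rewrite ge0_fin_numE//; apply: le_lt_trans Gfin; rewrite leeDr// lee_fin.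
by have := le_trans gf (leeD2l (f k)%:E FG); rewrite leeD2rE// lee_fin.
Qed.

(** * The energy inequality *)

(** Only the descents of [a] count on the right-hand side, because the descents
    of [b] are matched with descents of [a]. This sharper form of the inequality
    also settles the case of equality. *)
Lemma rearranges_energy_le {R : realType} (w a b : nat -> R) (p : R) :
  (forall n, 0 <= w n) -> nondecreasing_seq w -> 1 <= p ->
  (forall t, 0 < t -> finite_set (level a t)) -> rearranges b a ->
  (\sum_(0 <= n <oo) (`|b n - b n.+1| `^ p * w n)%:E <=
   \sum_(0 <= m <oo) (Num.max 0 (a m - a m.+1) `^ p * w m)%:E)%E.
Proof.
move=> w0 w_inc p1 afin ba; have b_dec := rearranges_nonincreasing _ _ ba.
have p0 : 0 < p by exact: lt_le_trans p1.
have db0 n : 0 <= b n - b n.+1 by rewrite subr_ge0.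
have /choice[phi phiP] n : exists m, b n.+1 < b n ->
    [/\ (n <= m)%N, b n <= a m & a m.+1 <= b n.+1].
  have [/(rearranges_descent _ _ _ afin ba)[m mP]|] := ltP (b n.+1) (b n).
    by exists m.
  (* Where [b] is constant its term vanishes, so any index serves. *)
  by exists 0%N.
apply: (nneseries_le_fibres _ _ phi) => [n|n|m N].
- by rewrite mulr_ge0 ?powR_ge0.
- by rewrite mulr_ge0 ?powR_ge0.
pose P n := (phi n == m) && (b n.+1 < b n).
apply: (@le_trans _ _ (\sum_(0 <= n < N | P n) (b n - b n.+1) `^ p * w m)).
  rewrite [leRHS]big_mkcondr/=; apply: ler_sum => n /eqP <-.
  rewrite ger0_norm//; case: ifPn => [/phiP[nm _ _]|].
    by apply: ler_wpM2l; [exact: powR_ge0|exact: w_inc].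
  rewrite -leNgt => bb; have -> : b n - b n.+1 = 0.
    by apply/eqP; rewrite subr_eq0 eq_le bb b_dec.
  by rewrite powR0 ?gt_eqF// mul0r.
rewrite -mulr_suml; apply: ler_wpM2r => //.
apply: le_trans (powR_sum_le _ _ _ _ _ p1 _) _ => //.
apply: ge0_ler_powR; rewrite ?nnegrE ?(ltW p0) ?sumr_ge0//.
  by rewrite le_max lexx.
by apply: sum_matched_descents => // n /andP[/eqP <- /phiP[_ bn an]].
Qed.

Lemma cmod_dist {R : realType} (x y : R[i]) :
  `|cmod x - cmod y| <= cmod (x - y).
Proof.
have tri (v z : R[i]) : cmod v - cmod z <= cmod (v - z).
  by rewrite lerBlDr; have := @le_normcD R (v - z) z; rewrite subrK.
rewrite ler_norml tri andbT lerNl opprB.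
by have := @normcN R (x - y); rewrite opprB => <-; exact: tri.
Qed.

Theorem theorem2p2 (R : realType) (w : nat -> R) (u : nat -> R[i])
    (w_ge0 : forall n, 0 <= w n) (w_incr : nondecreasing_seq w)
    (u_vanish : vanishes_at_infinity u) (p : R) (p_ge1 : 1 <= p) :
  let lhs : \bar R :=
    (\sum_(0 <= n <oo) (cmod (u n - u n.+1) `^ p * w n)%:E)%E in
  let rhs : \bar R :=
    (\sum_(0 <= n <oo)
      (`|decr_rearr u n - decr_rearr u n.+1| `^ p * w n)%:E)%E in
  (rhs <= lhs)%E /\
  ((forall n, 0 < w n) -> (lhs < +oo)%E -> lhs = rhs ->
    (fun n => cmod (u n)) = decr_rearr u /\
    nonincreasing_seq (fun n => cmod (u n))).
Proof.
move=> lhs rhs; pose a n := cmod (u n).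
have p0 : 0 < p by exact: lt_le_trans p_ge1.
have a0 n : 0 <= a n by exact: cmod_ge0.
have ba : rearranges (decr_rearr u) a.
  by split=> n; have [] := decr_rearr_gt _ u_vanish n.
pose e m := Num.max 0 (a m - a m.+1) `^ p * w m.
have e_ge0 m : 0 <= e m by rewrite mulr_ge0 ?powR_ge0.
have e_le m : e m <= cmod (u m - u m.+1) `^ p * w m.
  have := le_trans (ler_norm _) (cmod_dist (u m) (u m.+1)) => du.
  have du0 := cmod_ge0 (u m - u m.+1).
  apply: ler_wpM2r => //; apply: ge0_ler_powR; rewrite ?nnegrE ?(ltW p0)//.
    by rewrite le_max lexx.
  by rewrite ge_max du0.
have rhs_le : (rhs <= \sum_(0 <= m <oo) (e m)%:E)%E.
  exact: rearranges_energy_le.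
have lhs_ge : (\sum_(0 <= m <oo) (e m)%:E <= lhs)%E.
  by apply: lee_nneseries => [n _ _|n _]; rewrite lee_fin.
split=> [|w_gt0 lhs_fin lhs_rhs]; first exact: le_trans lhs_ge.
have e_eq : forall m, e m = cmod (u m - u m.+1) `^ p * w m.
  apply: (nneseries_eq_termwise e _ e_ge0 e_le lhs_fin).
  by rewrite -/lhs lhs_rhs.
have a_dec : nonincreasing_seq a.
  apply/nonincreasing_seqP => m; rewrite leNgt; apply/negP => asc.
  have : 0 < cmod (u m - u m.+1) `^ p * w m.
    rewrite mulr_gt0// powR_gt0// (lt_le_trans _ (cmod_dist _ _))//.
    by rewrite normr_gt0 subr_eq0 lt_eqF.
  rewrite -e_eq /e max_l ?subr_le0 ?ltW//.
  by rewrite powR0 ?gt_eqF// mul0r ltxx.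
by split=> //; apply: rearranges_id.
Qed.
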